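(* Over $\mathbb{Q}$, the Schur algebra $S(2,d)$ is isomorphic with $\mathcal{B}_d$. The set of all $e^aH_1^bf^c$ with $a,b,c\ge0$ and $a+b+c\le d$ is a $\mathbb{Q}$-basis of $\mathcal{B}_d$, as is the set of all $f^aH_2^be^c$ with $a,b,c\ge0$ and $a+b+c\le d$.
   Context: Fix an integer $d\ge 0$. $\mathcal{B}_d$ is the associative $\mathbb{Q}$-algebra with $1$ generated by $e,f,H_1,H_2$ subject to the relations $H_1H_2=H_2H_1$, $H_1e-eH_1=e$, $H_1f-fH_1=-f$, $H_2e-eH_2=-e$, $H_2f-fH_2=f$, $ef-fe=H_1-H_2$, $H_1+H_2=d$, and $H_1(H_1-1)\cdots(H_1-d)=0$. Let $E=\mathbb{Q}^2$; the Schur algebra $S(2,d)$ is the image of the group algebra $\mathbb{Q}GL_2(\mathbb{Q})$ acting diagonally on $E^{\otimes d}$, equivalently the image of the differentiated representation $\rho_d:U(\mathfrak{gl}_2)\to\mathrm{End}(E^{\otimes d})$. *)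

(* Defs.v *)
From HB Require Import structures.
From mathcomp Require Import all_boot all_order all_algebra.
Set Implicit Arguments. Unset Strict Implicit. Unset Printing Implicit Defensive.
Import Order.TTheory GRing.Theory Num.Theory.
Local Open Scope ring_scope.

Definition Brels (B : algType rat) (d : nat) (e f h1 h2 : B) : Prop :=
  h1 * h2 = h2 * h1 /\
  h1 * e - e * h1 = e /\
  h1 * f - f * h1 = - f /\
  h2 * e - e * h2 = - e /\
  h2 * f - f * h2 = f /\
  e * f - f * e = h1 - h2 /\
  h1 + h2 = d%:R /\
  \prod_(i < d.+1) (h1 - i%:R) = 0.

Definition is_alg_hom (A B : algType rat) (phi : A -> B) : Prop :=
  (forall (k : rat) (x y : A), phi (k *: x + y) = k *: phi x + phi y) /\
  (forall x y : A, phi (x * y) = phi x * phi y) /\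
  phi 1 = 1.

Definition generated_by (A : algType rat) (e f h1 h2 : A) : Prop :=
  forall P : A -> Prop,
    P 1 -> P e -> P f -> P h1 -> P h2 ->
    (forall (k : rat) x y, P x -> P y -> P (k *: x + y)) ->
    (forall x y, P x -> P y -> P (x * y)) ->
    forall x, P x.

(* (A, e, f, H1, H2) is the algebra B_d: the unital Q-algebra generated by
   e, f, H1, H2 subject to the relations Brels, characterized by its
   universal property. *)
Definition presents_Bd (A : algType rat) (d : nat) (e f h1 h2 : A) : Prop :=
  Brels d e f h1 h2 /\
  generated_by e f h1 h2 /\
  (forall (B : algType rat) (e' f' h1' h2' : B),
     Brels d e' f' h1' h2' ->
     exists! phi : A -> B,
       is_alg_hom phi /\ phi e = e' /\ phi f = f' /\ phi h1 = h1' /\ phi h2 = h2').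

(* E^{(x) d} has basis indexed by functions 'I_d -> 'I_2 (i.e. words
   e_{i_1} (x) ... (x) e_{i_d}); we index matrices by 'I_(tdim d) via enum_val. *)
Definition tidx (d : nat) := {ffun 'I_d -> 'I_2}.
Definition tdim (d : nat) : nat := #|{: tidx d}|.

Definition tensor_pow (d : nat) (g : 'M[rat]_2) : 'M[rat]_(tdim d) :=
  \matrix_(i, j) \prod_(k < d) g ((enum_val i : tidx d) k) ((enum_val j : tidx d) k).

(* S(2,d): the image of the group algebra Q GL_2(Q) in End(E^{(x) d}),
   i.e. the Q-span of the g^{(x) d}, g invertible. *)
Definition in_schur (d : nat) (M : 'M[rat]_(tdim d)) : Prop :=
  exists s : seq (rat * 'M[rat]_2),
    all (fun p => \det p.2 != 0) s /\
    M = \sum_(p <- s) p.1 *: tensor_pow d p.2.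

Definition is_mx_alg_hom (A : algType rat) (n : nat) (phi : A -> 'M[rat]_n) : Prop :=
  (forall (k : rat) (x y : A), phi (k *: x + y) = k *: phi x + phi y) /\
  (forall x y : A, phi (x * y) = phi x *m phi y) /\
  phi 1 = 1%:M.

Definition triple (d : nat) := ('I_d.+1 * 'I_d.+1 * 'I_d.+1)%type.
Definition triple_ok (d : nat) (t : triple d) : bool :=
  (t.1.1 + t.1.2 + t.2 <= d)%N.

Definition is_basis (A : lmodType rat) (I : finType) (P : pred I) (v : I -> A) : Prop :=
  (forall x : A, exists c : I -> rat, x = \sum_(i | P i) c i *: v i) /\
  (forall c : I -> rat, \sum_(i | P i) c i *: v i = 0 -> forall i, P i -> c i = 0).

(* Main.v *)
(** The commutation relations put every element in the form of a combination of
    e^a p(h1) f^c, p a polynomial. The truncation relation and commutation with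
    e give e^a T_b(h1) = 0 for a + b = d + 1, T_b the falling factorial; applying
    ad f repeatedly turns this into: e^a T_b(h1) f^c with a + b + c = d + 1 lies
    in the span F of the monomials of degree at most d. Hence F is a left ideal
    containing 1, i.e. the monomials span.

    On E^{(x) d} the tensor power of 1 + c E_ij is a polynomial in the operator
    drho E_ij, so the image V of the representation contains S(2,d). The entries
    of the d-th tensor power of [[x, t], [u, 1]] include all x^b t^a u^c with
    a + b + c <= d, so S(2,d) has at least as many dimensions as there are
    monomials; these span V, so they are independent and V = S(2,d).
    The second basis comes from the symmetry e <-> f, h1 <-> h2. *)
Require Import Defs.
From HB Require Import structures.
From mathcomp Require Import all_boot all_order all_algebra.
From mathcomp Require Import zify ring.
Set Implicit Arguments. Unset Strict Implicit. Unset Printing Implicit Defensive.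
Import Order.TTheory GRing.Theory Num.Theory.
Local Open Scope ring_scope.

(** * Linear spans of finite families *)

Definition spanned (A : lmodType rat) (I : finType) (P : pred I) (v : I -> A)
    (x : A) : Prop :=
  exists c : I -> rat, x = \sum_(i | P i) c i *: v i.

Section Spanned.
Variables (A : lmodType rat) (I : finType) (P : pred I) (v : I -> A).

Lemma spanned_comb (k : rat) (x y : A) :
  spanned P v x -> spanned P v y -> spanned P v (k *: x + y).
Proof.
move=> [c ->] [c' ->]; exists (fun i => k * c i + c' i).
by rewrite scaler_sumr -big_split; apply: eq_bigr => i _; rewrite scalerDl scalerA.
Qed.

Lemma spanned0 : spanned P v 0.
Proof. by exists (fun=> 0); rewrite big1 // => i _; rewrite scale0r. Qed.

Lemma spannedZ (k : rat) (x : A) : spanned P v x -> spanned P v (k *: x).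
Proof. by move=> hx; rewrite -[k *: x]addr0; apply: spanned_comb hx spanned0. Qed.

Lemma spannedD (x y : A) : spanned P v x -> spanned P v y -> spanned P v (x + y).
Proof. by move=> hx hy; rewrite -[x]scale1r; apply: spanned_comb. Qed.

Lemma spanned_gen (i : I) : P i -> spanned P v (v i).
Proof.
move=> Pi; exists (fun j => (j == i)%:R); rewrite (bigD1 i) //= eqxx scale1r big1 ?addr0 //.
by move=> j /andP[_ /negbTE ->]; rewrite scale0r.
Qed.

Lemma spanned_ind (Q : A -> Prop) :
    Q 0 -> (forall (k : rat) x y, Q x -> Q y -> Q (k *: x + y)) ->
    (forall i, P i -> Q (v i)) ->
  forall x, spanned P v x -> Q x.
Proof.
move=> Q0 Qlin Qgen x [c ->]; apply: (big_ind Q) => //.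
- by move=> y z Qy Qz; rewrite -[y]scale1r; apply: Qlin.
- by move=> i Pi; rewrite -[_ *: _]addr0; apply: Qlin => //; apply: Qgen.
Qed.

End Spanned.

(** * Polynomials, their evaluation in an algebra, and falling factorials *)

Lemma horner_alg_comp (R : comNzRingType) (A : algType R) (a : A) (p q : {poly R}) :
  horner_alg a (p \Po q) = horner_alg (horner_alg a q) p.
Proof.
elim/poly_ind: p => [|p c IH]; first by rewrite comp_poly0 !rmorph0.
by rewrite comp_polyD comp_polyM comp_polyX comp_polyC !rmorphD !rmorphM /= IH
           !horner_algX !horner_algC.
Qed.

Lemma horner_alg_intertwine (R : comNzRingType) (A : algType R) (a b x : A)
    (p : {poly R}) :
  a * x = x * b -> horner_alg a p * x = x * horner_alg b p.
Proof.
move=> axb; elim/poly_ind: p => [|p c IH]; first by rewrite !rmorph0 mul0r mulr0.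
rewrite !rmorphD !rmorphM /= !horner_algX !horner_algC mulrDl mulrDr -mulrA axb.
by rewrite !mulrA IH mulr_algl mulr_algr.
Qed.

Lemma size_sub_lt (R : nzRingType) (p q : {poly R}) :
  p != 0 -> size p = size q -> lead_coef p = lead_coef q -> (size (p - q)%R < size p)%N.
Proof.
move=> p0 spq lpq; have sp : (0 < size p)%N by rewrite lt0n size_poly_eq0.
rewrite -(prednK sp) ltnS; apply/leq_sizeP => j; rewrite leq_eqVlt => /predU1P[<-|lj].
  by rewrite coefB {2}spq -!lead_coefE lpq subrr.
by rewrite coefB !nth_default ?subrr // -?spq -(prednK sp).
Qed.

(** [p] and its shift share size and leading coefficient, so the difference operator lowers the
    degree. *)
Lemma size_shift_diff (p : {poly rat}) :
  p != 0 -> (size ((p \Po ('X + 1)) - p)%R < size p)%N.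
Proof.
move=> p0; have s2 : size ('X + 1 : {poly rat}) = 2 by rewrite size_XaddC.
have sp : size (p \Po ('X + 1)) = size p by rewrite size_comp_poly2.
rewrite -sp; apply: size_sub_lt => //; first by rewrite -size_poly_eq0 sp size_poly_eq0.
by rewrite lead_coef_comp ?s2 // lead_coefXaddC expr1n mulr1.
Qed.

Definition falling (b : nat) : {poly rat} := \prod_(i < b) ('X - i%:R%:P).

Lemma size_falling b : size (falling b) = b.+1.
Proof. by rewrite size_prod_XsubC /index_enum -enumT size_enum_ord. Qed.

Lemma falling_monic b : falling b \is monic.
Proof. exact: monic_prod_XsubC. Qed.

(** The discrete analogue of differentiating a power; in characteristic 0 it recovers T_b from the
    difference of T_(b+1). *)
Lemma falling_diff b :
  (falling b.+1 \Po ('X + 1)) - falling b.+1 = b.+1%:R *: falling b.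
Proof.
have -> : falling b.+1 \Po ('X + 1) = ('X + 1) * falling b.
  rewrite /falling big_ord_recl rmorphM rmorph_prod /= subr0 comp_polyX.
  congr (_ * _); apply: eq_bigr => i _.
  by rewrite comp_polyB comp_polyX comp_polyC /bump leq0n add1n -nat1r polyCD polyC1; ring.
rewrite /falling big_ord_recr /= -mul_polyC polyC_natr polyC_natr; ring.
Qed.

(** * The monomials span *)

Section Spanning.
Variables (A : algType rat) (d : nat) (e f h1 h2 : A).
Hypothesis rel : Brels d e f h1 h2.

Let hp := horner_alg h1.

Let hpZ k p : hp (k *: p) = k *: hp p.
Proof. by rewrite /hp linearZ /= mulr_algl. Qed.

Let he : h1 * e = e * (h1 + 1).
Proof.
by case: rel => _ [+ _] => /eqP; rewrite subr_eq addrC => /eqP ->; rewrite mulrDr mulr1.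
Qed.

Let fh : f * h1 = (h1 + 1) * f.
Proof.
case: rel => _ [_ [+ _]] => /eqP; rewrite subr_eq => /eqP E.
by rewrite mulrDl mul1r E addrC addrA subrr add0r.
Qed.

Let fe : f * e = e * f - hp ('X *+ 2 - d%:R).
Proof.
case: rel => _ [_ [_ [_ [_ [E [D _]]]]]].
have -> : hp ('X *+ 2 - d%:R) = h1 - h2.
  rewrite /hp rmorphB rmorphMn rmorph_nat /= horner_algX -D mulr2n opprD addrA.
  by rewrite addrK.
by rewrite -E opprB addrC subrK.
Qed.

Let hp_shift (p : {poly rat}) : hp (p \Po ('X + 1)) = horner_alg (h1 + 1) p.
Proof. by rewrite /hp horner_alg_comp rmorphD rmorph1 /= horner_algX. Qed.

Let hpe p : hp p * e = e * hp (p \Po ('X + 1)).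
Proof. by rewrite hp_shift; apply: horner_alg_intertwine. Qed.

Let fhp p : f * hp p = hp (p \Po ('X + 1)) * f.
Proof. by rewrite hp_shift; apply/esym/horner_alg_intertwine. Qed.

(** The usual sl_2 commutator of f with a power of e; ['X *+ 2 - d%:R] evaluates to h1 - h2 because
    h2 = d - h1. *)
Let fX a : f * e ^+ a.+1 =
  e ^+ a.+1 * f - a.+1%:R *: (e ^+ a * hp ('X *+ 2 - d%:R + a%:R)).
Proof.
elim: a => [|a IH]; first by rewrite expr1 expr0 mul1r scale1r addr0 fe.
rewrite [in LHS]exprSr mulrA IH mulrBl -[_ * f * e]mulrA fe mulrBr mulrA -exprSr.
rewrite -[LHS]addrA; congr (_ + _); rewrite -opprD; congr (- _).
rewrite -scalerAl -mulrA hpe mulrA -exprSr scalerAr -mulrDr.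
rewrite scalerAr -hpZ -rmorphD -hpZ; congr (_ * hp _).
rewrite comp_polyD comp_polyB rmorphMn !rmorph_nat /= comp_polyX.
rewrite -!mul_polyC !polyC_natr; ring.
Qed.

(** An arbitrary polynomial in the middle lets shifts and differences be applied without expanding
    into powers of h1. *)
Let mon a p c := e ^+ a * hp p * f ^+ c.

Let monD a p q c : mon a (p + q) c = mon a p c + mon a q c.
Proof. by rewrite /mon /hp rmorphD mulrDr mulrDl. Qed.

Let monZ a k p c : mon a (k *: p) c = k *: mon a p c.
Proof. by rewrite /mon hpZ -scalerAr -scalerAl. Qed.

Let mon0 a c : mon a 0 c = 0.
Proof. by rewrite /mon /hp rmorph0 mulr0 mul0r. Qed.

Let e_mon a p c : e * mon a p c = mon a.+1 p c.
Proof. by rewrite /mon exprS !mulrA. Qed.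

Let mon_f a p c : mon a p c * f = mon a p c.+1.
Proof. by rewrite /mon exprSr !mulrA. Qed.

Let h_mon a p c : h1 * mon a p c = mon a (('X + a%:R) * p) c.
Proof.
have heX : h1 * e ^+ a = e ^+ a * (h1 + a%:R).
  elim: a => [|a IH]; first by rewrite expr0 mulr1 mul1r addr0.
  rewrite exprSr mulrA IH -!mulrA mulrDl he [in RHS]mulrA -natr1.
  by rewrite -mulrA -(commr_nat e a) -mulrDr [in RHS]addrA addrAC.
rewrite /mon /hp rmorphM rmorphD rmorph_nat /= horner_algX.
by rewrite !mulrA heX.
Qed.

Let f_mon a p c : f * mon a p c =
  mon a (p \Po ('X + 1)) c.+1 - a%:R *: mon a.-1 (('X *+ 2 - d%:R + a.-1%:R) * p) c.
Proof.
case: a => [|a]; rewrite /mon !mulrA.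
  by rewrite scale0r subr0 !expr0 mulr1 mul1r fhp -mulrA -exprS.
rewrite fX !mulrBl -[_ * f * hp p]mulrA fhp /= /hp rmorphM -!scalerAl [f ^+ c.+1]exprS.
by rewrite !mulrA.
Qed.

Let size_lin_mul (a : nat) (p : {poly rat}) :
  (size (('X *+ 2 - d%:R + a%:R) * p)%R <= (size p).+1)%N.
Proof.
have -> : 'X *+ 2 - d%:R + a%:R = 2%:R *: ('X + ((a%:R - d%:R) / 2%:R)%:P) :> {poly rat}.
  rewrite scalerDr -mul_polyC -[_ *: _%:P]mul_polyC -polyCM mulrCA divff // mulr1.
  by rewrite polyCB !polyC_natr; ring.
rewrite -scalerAl size_scale //.
by apply: leq_trans (size_polyMleq _ _) _; rewrite size_XaddC.
Qed.

Let F := spanned (triple_ok (d:=d)) (fun t : triple d => e ^+ t.1.1 * h1 ^+ t.1.2 * f ^+ t.2).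

(** The size exceeds the degree by one, so the bound [d.+1] means total degree at most d. *)
Let F_mon n a (p : {poly rat}) c :
  (size p <= n)%N -> (a + n + c <= d.+1)%N -> F (mon a p c).
Proof.
move=> spn le; rewrite -[p]coefK poly_def.
elim/big_rec: _ => [|i q _ Fq]; first by rewrite mon0; apply: spanned0.
rewrite monD; apply: spannedD => //; rewrite monZ; apply: spannedZ.
move: (leq_trans (ltn_ord i) spn); move: (nat_of_ord i) => k lk.
have -> : mon a 'X^k c = e ^+ a * h1 ^+ k * f ^+ c by rewrite /mon /hp rmorphXn /= horner_algX.
have := @spanned_gen A (triple d) (@triple_ok d)
  (fun t : triple d => e ^+ t.1.1 * h1 ^+ t.1.2 * f ^+ t.2)
  (inord a, inord k, inord c).
rewrite /triple_ok /= !inordK; [apply | | | ]; lia.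
Qed.

(** ad f does not raise the total degree: one term gains a factor f but has the difference of p in
    the middle, the other loses a factor e while the degree of p grows by at most one. *)
Let F_adf x : F x -> F (f * x - x * f).
Proof.
elim/spanned_ind: x / => [|k x y Fx Fy|[[a b] c]].
- by rewrite mulr0 mul0r subr0; apply: spanned0.
- have -> : f * (k *: x + y) - (k *: x + y) * f = k *: (f * x - x * f) + (f * y - y * f).
    by rewrite mulrDr mulrDl -scalerAr -scalerAl scalerBr opprD addrACA.
  exact: spanned_comb.
rewrite /triple_ok /= => le.
have -> : e ^+ a * h1 ^+ b * f ^+ c = mon a 'X^b c by rewrite /mon /hp rmorphXn /= horner_algX.
have sX : size ('X^b : {poly rat}) = b.+1 by rewrite size_polyXn.
(* The two terms ending in f^(c+1) merge into one whose middle is a difference. *)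
rewrite f_mon mon_f addrAC -[- mon _ 'X^b _]scaleN1r -monZ -monD scaleN1r -scaleNr.
apply: spannedD.
  have X0 : ('X^b : {poly rat}) != 0 by rewrite -size_poly_eq0 sX.
  have := size_shift_diff X0; rewrite sX ltnS => lt; apply: (F_mon lt); lia.
case: (nat_of_ord a) le => [|a'] le.
  by rewrite oppr0 scale0r; apply: spanned0.
by have := size_lin_mul a' 'X^b; rewrite sX => ls; apply/spannedZ/(F_mon ls); lia.
Qed.

(** Reaches total degree d + 1, one more than [F_mon]. Subtracting a multiple of T_b cancels the
    leading term of p, so in top degree only the middle factors T_b need checking. *)
Let F_mon_of c :
    (forall a b, (a + b + c = d.+1)%N -> F (mon a (falling b) c)) ->
  forall n a (p : {poly rat}), (size p <= n)%N -> (a + n + c <= d.+2)%N -> F (mon a p c).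
Proof.
move=> Fc n a p spn lt; have {n spn lt} : (a + size p + c <= d.+2)%N by lia.
have [->|p0] := eqVneq p 0; first by rewrite mon0 => _; apply: spanned0.
rewrite leq_eqVlt => /predU1P[E|]; last exact: F_mon (leqnn _).
have sp : size p = (size p).-1.+1 by rewrite prednK // lt0n size_poly_eq0.
set b := (size p).-1 in sp; set q := lead_coef p *: falling b.
have lp0 : lead_coef p != 0 by rewrite lead_coef_eq0.
have lt : (size (p - q)%R < size p)%N.
  apply: size_sub_lt => //; first by rewrite size_scale // size_falling.
  by rewrite lead_coefZ (monicP (falling_monic b)) mulr1.
rewrite -[p](subrKC q) monD; apply: spannedD; last first.
  by move: lt; rewrite sp ltnS => lt; apply: (F_mon lt); lia.
by rewrite monZ; apply/spannedZ/Fc; lia.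
Qed.

(** Induction on a from the truncation relation: multiplying e^a T_(b+1)(h1) = 0 by e on the left
    and on the right gives two relations whose difference is (b+1) e^(a+1) T_b(h1) = 0. *)
Let e_falling a b : (a + b = d.+1)%N -> e ^+ a * hp (falling b) = 0.
Proof.
elim: a b => [|a IH] b E.
  case: rel => _ [_ [_ [_ [_ [_ [_ <-]]]]]].
  rewrite mul1r -E /hp rmorph_prod; apply: eq_bigr => i _ /=.
  by rewrite rmorphB /= horner_algX horner_algC -in_algE rmorph_nat.
have E' : (a + b.+1 = d.+1)%N by lia.
have z1 : e ^+ a.+1 * hp (falling b.+1) = 0 by rewrite exprS -mulrA IH ?mulr0.
have z2 : e ^+ a.+1 * hp (falling b.+1 \Po ('X + 1)) = 0.
  by rewrite exprSr -mulrA -hpe mulrA IH ?mul0r.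
have : b.+1%:R *: (e ^+ a.+1 * hp (falling b)) = 0.
  by rewrite scalerAr -hpZ -falling_diff /hp rmorphB mulrBr z2 z1 subr0.
by move/eqP; rewrite scaler_eq0 pnatr_eq0 => /eqP.
Qed.

(** Induction on c. Up to the factor b + 1, the element is ad f of [mon a (falling b.+1) c] plus a
    multiple of a monomial of degree at most d + 1 that still ends in f^c; the induction hypothesis
    covers both. *)
Let F_falling c a b : (a + b + c = d.+1)%N -> F (mon a (falling b) c).
Proof.
elim: c a b => [|c IH] a b E.
  by rewrite /mon e_falling ?mul0r; [apply: spanned0 | lia].
have b0 : (b.+1%:R : rat) != 0 by rewrite pnatr_eq0.
rewrite -[mon _ _ _]scale1r -(mulVf b0) -scalerA; apply: spannedZ.
rewrite -monZ -falling_diff.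
set m := mon a (falling b.+1) c.
have -> : mon a ((falling b.+1 \Po ('X + 1)) - falling b.+1) c.+1 =
    a%:R *: mon a.-1 (('X *+ 2 - d%:R + a.-1%:R) * falling b.+1) c + (f * m - m * f).
  rewrite /m f_mon mon_f monD -scaleN1r monZ scaleN1r.
  by rewrite [RHS]addrC addrAC subrK.
apply: spannedD; last first.
  by apply: F_adf; apply: (F_mon_of _ (n := b.+2)); rewrite ?size_falling //; lia.
case: a {m} E => [|a] E; first by rewrite scale0r; apply: spanned0.
have := size_lin_mul a (falling b.+1); rewrite size_falling => ls.
by apply: spannedZ; apply: (F_mon_of _ ls) => //; lia.
Qed.

Let F_top n a (p : {poly rat}) c :
  (size p <= n)%N -> (a + n + c <= d.+2)%N -> F (mon a p c).
Proof. by apply: F_mon_of => a' b'; apply: F_falling. Qed.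

(** Each of e, f and h1 raises the degree of a monomial by at most one under left multiplication,
    and degree d + 1 is covered by [F_top]. *)
Let F_mulr (x y : A) : (forall a b c, (a + b + c <= d)%N -> F (x * mon a 'X^b c)) ->
  F y -> F (x * y).
Proof.
move=> Fx; elim/spanned_ind: y / => [|k y z Fy Fz|[[a b] c]].
- by rewrite mulr0; apply: spanned0.
- by rewrite mulrDr -scalerAr; apply: spanned_comb.
rewrite /triple_ok /= => le.
have <- : mon a 'X^b c = e ^+ a * h1 ^+ b * f ^+ c by rewrite /mon /hp rmorphXn /= horner_algX.
exact: Fx.
Qed.

Let F_e y : F y -> F (e * y).
Proof.
apply: F_mulr => a b c le; rewrite e_mon; apply: (@F_top b.+1); rewrite ?size_polyXn //; lia.
Qed.

Let F_h1 y : F y -> F (h1 * y).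
Proof.
apply: F_mulr => a b c le; rewrite h_mon.
have := size_polyMleq ('X + a%:R%:P) ('X^b : {poly rat}).
by rewrite size_XaddC size_polyXn polyC_natr => ls; apply: (F_top ls); lia.
Qed.

Let F_f y : F y -> F (f * y).
Proof.
apply: F_mulr => a b c le; rewrite f_mon addrC -scaleNr; apply: spanned_comb; last first.
  by apply: (@F_top b.+1); rewrite ?size_comp_poly2 ?size_XaddC ?size_polyXn //; lia.
have := size_lin_mul a.-1 'X^b; rewrite size_polyXn => ls; apply: (F_top ls); lia.
Qed.

Let F_h2 y : F y -> F (h2 * y).
Proof.
case: rel => _ [_ [_ [_ [_ [_ [D _]]]]]] Fy.
have -> : h2 = d%:R - h1 by rewrite -D addrC addKr.
rewrite mulrBl mulr_natl -scaler_nat addrC -scaleN1r.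
by apply: spanned_comb; [apply: F_h1 | apply: spannedZ].
Qed.

Lemma Bd_spanned : generated_by e f h1 h2 ->
  forall x : A, spanned (triple_ok (d:=d))
    (fun t : triple d => e ^+ t.1.1 * h1 ^+ t.1.2 * f ^+ t.2) x.
Proof.
move=> gen x; rewrite -[x]mulr1.
have F1 : F 1.
  have -> : 1 = mon 0 1 0 by rewrite /mon /hp rmorph1 !mulr1.
  by apply: (@F_top 1); rewrite ?size_poly1.
(* The property propagated along generation is that left multiplication by x preserves F. *)
elim/gen: x 1 F1 => [|||||k x y Fx Fy|x y Fx Fy] z Fz.
- by rewrite mul1r.
- exact: F_e.
- exact: F_f.
- exact: F_h1.
- exact: F_h2.
- by rewrite mulrDl -scalerAl; apply: spanned_comb; [apply: Fx | apply: Fy].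
- by rewrite -mulrA; apply/Fx/Fy.
Qed.

End Spanning.

(** * Exponential and binomial expansions for commuting families *)

(** Powers for [eps] = 0, falling factorials for [eps] = 1: this treats the square-zero and the
    idempotent matrix units together. *)
Definition step_falling (R : pzRingType) (eps : nat) (x : R) (j : nat) : R :=
  \prod_(i < j) (x - (eps * i)%:R).

Lemma step_fallingS (R : pzRingType) eps (x : R) j :
  step_falling eps x j.+1 = step_falling eps x j * (x - (eps * j)%:R).
Proof. by rewrite /step_falling big_ord_recr. Qed.

(** Vandermonde's expansion, of which only two terms remain because x (x - [eps]) = 0. *)
Lemma step_falling_add (R : pzRingType) eps (x y : R) j :
  x * x = x *+ eps -> x * y = y * x ->
  step_falling eps (x + y) j.+1 =
    step_falling eps y j.+1 + (x * step_falling eps y j) *+ j.+1.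
Proof.
move=> xx xy; elim: j => [|j IH].
  by rewrite /step_falling !big_ord_recl !big_ord0 muln0 !subr0 !mulr1 addrC.
rewrite step_fallingS IH [step_falling eps y j.+2]step_fallingS.
set G := step_falling eps y j.+1; set H := step_falling eps y j.
have GE : G = H * (y - (eps * j)%:R) by rewrite /G step_fallingS.
have xH : GRing.comm x H.
  by apply: commr_prod => i _; apply: commrB => //; apply: commr_nat.
have xG : x * G = G * x.
  by apply: commr_prod => i _; apply: commrB => //; apply: commr_nat.
rewrite [x + y]addrC addrAC mulrDl mulrDr -xG -[LHS]addrA; congr (_ + _).
rewrite mulrnAl [in RHS]mulrS; congr (_ + _); congr (_ *+ _).
have -> : y - (eps * j.+1)%:R + x = (y - (eps * j)%:R) + (x - eps%:R).
  rewrite mulnS natrD opprD [x - _]addrC [RHS]addrA; congr (_ + x).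
  by rewrite -addrA; congr (_ + _); rewrite addrC.
rewrite mulrDr -[in X in X + _]mulrA -GE.
by rewrite xH -mulrA mulrBr xx mulr_natr subrr mulr0 addr0.
Qed.

Section CommutingFamily.
Variables (I : eqType) (eps : nat).

Lemma step_falling_sum_eq0 (R : pzRingType) (x : I -> R) (r : seq I) j :
    (forall k l, x k * x l = x l * x k) -> (forall k, x k * x k = x k *+ eps) ->
  (size r < j)%N -> step_falling eps (\sum_(k <- r) x k) j = 0.
Proof.
move=> xC xx; elim: r j => [|k r IH] [|j] //= lt.
  by rewrite big_nil /step_falling big_ord_recl muln0 subr0 mul0r.
rewrite big_cons step_falling_add // ?IH ?mulr0 ?mul0rn ?addr0 //; first exact: ltnW.
by apply: commr_sum => l _; apply: xC.
Qed.

(* For eps = 0 this is exp(c X) = prod exp(c x_k), for eps = 1 it is the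
   binomial expansion of (1 + c)^X. *)
Lemma prod_1D_step_falling (A : algType rat) (x : I -> A) (c : rat) (r : seq I) m :
    (forall k l, x k * x l = x l * x k) -> (forall k, x k * x k = x k *+ eps) ->
    (size r < m)%N ->
  \prod_(k <- r) (1 + c *: x k) =
    \sum_(j < m) (c ^+ j / j`!%:R) *: step_falling eps (\sum_(k <- r) x k) j.
Proof.
move=> xC xx; elim: r m => [|k r IH] [|m] //= lt.
  rewrite big_nil big_ord_recl /= expr0 divr1 scale1r /step_falling big_ord0.
  rewrite big1 ?addr0 // => i _.
  by rewrite big_nil big_ord_recl muln0 subr0 mul0r scaler0.
(* Two truncation lengths are used so that term j + 1 of the first sum pairs with term j of the
   second. *)
rewrite !big_cons mulrDl mul1r {1}(IH m.+1 (ltnW lt)) (IH m lt).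
rewrite !big_ord_recl /= -addrA; congr (_ + _); first by rewrite /step_falling !big_ord0.
rewrite mulr_sumr -big_split; apply: eq_bigr => j _ /=.
rewrite /bump leq0n add1n step_falling_add //; last first.
  by apply: commr_sum => l _; apply: xC.
rewrite scalerDr; congr (_ + _).
rewrite -scalerAl -scalerAr scalerA -scaler_nat scalerA; congr (_ *: _).
have j0 : (j.+1%:R : rat) != 0 by rewrite pnatr_eq0.
have f0 : (j`!%:R : rat) != 0 by rewrite pnatr_eq0 -lt0n fact_gt0.
by rewrite exprS factS natrM; field; rewrite f0 nat1r j0.
Qed.

(** The algebra structure on matrices asks for a size of the form [n.+1], a form [tdim d] does not
    show; in size 0 all matrices are equal. *)
Lemma prod_1D_step_falling_mx n (x : I -> 'M[rat]_n) (c : rat) (r : seq I) :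
    (forall k l, x k * x l = x l * x k) -> (forall k, x k * x k = x k *+ eps) ->
  \prod_(k <- r) (1 + c *: x k) =
    \sum_(j < (size r).+1) (c ^+ j / j`!%:R) *:
      step_falling eps (\sum_(k <- r) x k) j.
Proof.
case: n x => [|n] x xC xx; first by rewrite [LHS]flatmx0 [RHS]flatmx0.
exact: (prod_1D_step_falling (A := 'M[rat]_n.+1)).
Qed.

End CommutingFamily.

(** * Operators on the tensor power *)

Section Tensor.
Variable d : nat.

Definition tensor (g : 'I_d -> 'M[rat]_2) : 'M[rat]_(tdim d) :=
  \matrix_(i, j) \prod_(k < d) g k ((enum_val i : tidx d) k) ((enum_val j : tidx d) k).

Lemma eq_tensor g h : g =1 h -> tensor g = tensor h.
Proof. by move=> gh; apply/matrixP=> i j; rewrite !mxE; apply: eq_bigr => k _; rewrite gh. Qed.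

Lemma tensorM g h : tensor g * tensor h = tensor (fun k => g k * h k).
Proof.
apply/matrixP=> i j; rewrite !mxE.
under [RHS]eq_bigr => k _ do rewrite mxE.
(* A product over slots of sums over ['I_2] is a sum over words. *)
rewrite bigA_distr_bigA /= (reindex (fun l : 'I_(tdim d) => enum_val l : tidx d)) /=.
  by apply: eq_bigr => l _; rewrite !mxE -big_split.
exact/onW_bij/enum_val_bij.
Qed.

Lemma tensor1 : tensor (fun=> 1) = 1.
Proof.
apply/matrixP=> i j; rewrite !mxE; under eq_bigr => k _ do rewrite mxE.
have [->|ne] := eqVneq i j; first by rewrite big1 // => k _; rewrite eqxx.
have /eqP/ffunP ne' : (enum_val i : tidx d) != enum_val j by rewrite (inj_eq enum_val_inj).
have [k nk] : exists k, (enum_val i : tidx d) k != (enum_val j : tidx d) k.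
  by apply/existsP; apply: contra_notT ne' => /existsPn H k; apply/eqP; have := H k; rewrite negbK.
by rewrite (bigD1 k) //= (negbTE nk) mul0r.
Qed.

Definition slot (k : 'I_d) (x : 'M[rat]_2) := tensor (fun l => if l == k then x else 1).

Lemma slot_lin k a x y : slot k (a *: x + y) = a *: slot k x + slot k y.
Proof.
apply/matrixP=> i j; rewrite !mxE !(bigD1 (P := xpredT) k) //= eqxx !mxE mulrDl mulrA.
congr (_ * _ + _ * _); apply: eq_bigr => l /negbTE lk; by rewrite lk.
Qed.

Lemma slotM k x y : slot k x * slot k y = slot k (x * y).
Proof. by rewrite /slot tensorM; apply: eq_tensor => l; case: ifP => // _; rewrite mulr1. Qed.

Lemma slot1 k : slot k 1 = 1.
Proof. by rewrite -[RHS]tensor1; apply: eq_tensor => l; case: ifP. Qed.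

Lemma slotC k l x y : k != l -> slot k x * slot l y = slot l y * slot k x.
Proof.
move=> kl; rewrite /slot !tensorM; apply: eq_tensor => m.
have [->|mk] := eqVneq m k; first by rewrite (negbTE kl) mulr1 mul1r.
by case: ifP => _; rewrite ?mulr1 ?mul1r.
Qed.

Lemma tensor_pow_slots (g : 'M[rat]_2) : tensor_pow d g = \prod_(k < d) slot k g.
Proof.
have H (r : seq 'I_d) : uniq r ->
    \prod_(k <- r) slot k g = tensor (fun l => if l \in r then g else 1).
  elim: r => [|k r IH] /=; first by rewrite big_nil -tensor1.
  case/andP=> kr /IH E; rewrite big_cons E tensorM; apply: eq_tensor => l.
  rewrite inE; have [->|] := eqVneq l k; first by rewrite (negbTE kr) mulr1.
  by rewrite mul1r.
rewrite H ?index_enum_uniq //; apply: eq_tensor => l; by rewrite mem_index_enum.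
Qed.

Lemma tensor_powM g h : tensor_pow d (g * h) = tensor_pow d g * tensor_pow d h.
Proof. exact/esym/tensorM. Qed.

(** The differentiated action of gl_2 on the tensor power. *)
Definition drho (x : 'M[rat]_2) := \sum_(k < d) slot k x.

Lemma drho_lin a x y : drho (a *: x + y) = a *: drho x + drho y.
Proof. by rewrite scaler_sumr -big_split; apply: eq_bigr => k _; apply: slot_lin. Qed.

Lemma drho1 : drho 1 = d%:R.
Proof. by rewrite /drho (eq_bigr (fun=> 1)) ?sumr_const ?card_ord // => k _; apply: slot1. Qed.

Lemma drhoB x y : drho (x - y) = drho x - drho y.
Proof. by rewrite addrC -scaleN1r drho_lin scaleN1r addrC. Qed.

Lemma drho0 : drho 0 = 0.
Proof. by rewrite -(subrr 0) drhoB subrr. Qed.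

(** Operators on different slots commute, so only the diagonal terms of the double sum survive. *)
Lemma drho_bracket x y : drho x * drho y - drho y * drho x = drho (x * y - y * x).
Proof.
rewrite /drho mulr_suml [X in _ - X]mulr_sumr -sumrB; apply: eq_bigr => k _.
rewrite mulr_sumr mulr_suml -sumrB (bigD1 k) //= big1 ?addr0 => [|l lk].
  by rewrite !slotM addrC -scaleN1r -slot_lin scaleN1r addrC.
by rewrite (slotC _ _ lk) subrr.
Qed.

Lemma slot_comm_self x k l : slot k x * slot l x = slot l x * slot k x.
Proof. by have [->//|kl] := eqVneq k l; apply: slotC. Qed.

Lemma slot_sq eps x k : x * x = x *+ eps -> slot k x * slot k x = slot k x *+ eps.
Proof.
move=> xx; rewrite slotM xx -scaler_nat -[_ *: x]addr0 slot_lin scaler_nat.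
have -> : slot k 0 = slot k (-1 *: 0 + 0) by rewrite scaler0 addr0.
by rewrite slot_lin scaleN1r addNr addr0.
Qed.

Lemma step_falling_drho eps x : x * x = x *+ eps -> step_falling eps (drho x) d.+1 = 0.
Proof.
move=> xx; apply: step_falling_sum_eq0.
- exact: slot_comm_self.
- by move=> k; apply: slot_sq.
- by rewrite /index_enum -enumT size_enum_ord.
Qed.

Lemma tensor_pow_1D eps x c : x * x = x *+ eps ->
  tensor_pow d (1 + c *: x) =
    \sum_(j < (size (index_enum 'I_d)).+1)
      (c ^+ j / j`!%:R) *: step_falling eps (drho x) j.
Proof.
move=> xx; rewrite -prod_1D_step_falling_mx; last first.
- by move=> k; apply: slot_sq.
- exact: slot_comm_self.
rewrite tensor_pow_slots; apply: eq_bigr => k _.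
by rewrite addrC slot_lin slot1 addrC.
Qed.

End Tensor.

(** * Linear algebra: independence by separation *)

(** A dimension count in matrix form. With K = (ev_i(m_j)) and D the coordinates of the g_p in the
    m_j, separation says that K D has independent rows. So the square matrix K is invertible and D
    has a right inverse, which expresses each m_j through the g_p. *)
Lemma free_of_spanned_separated (V : lmodType rat) (I J : finType) (P : pred I)
    (m : I -> V) (g : J -> V) (ev : I -> V -> rat) :
    (forall i k x y, ev i (k *: x + y) = k * ev i x + ev i y) ->
    (forall p, spanned P m (g p)) ->
    (forall z : I -> rat, (forall p, \sum_(i | P i) z i * ev i (g p) = 0) ->
       forall i, P i -> z i = 0) ->
  (forall c : I -> rat, \sum_(i | P i) c i *: m i = 0 -> forall i, P i -> c i = 0) /\
  (forall i, P i -> spanned xpredT g (m i)).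
Proof.
move=> evlin /fin_all_exists[C gC] sep.
have ev0 i : ev i 0 = 0.
  have := evlin i (-1) 0 0; rewrite scaler0 addr0 mulN1r => ->.
  by rewrite addNr.
have evsum i (L : finType) (Q : pred L) (c : L -> rat) (x : L -> V) :
    ev i (\sum_(l | Q l) c l *: x l) = \sum_(l | Q l) c l * ev i (x l).
  by elim/big_rec2: _ => // l r s _ <-; rewrite evlin.
pose n := #|P|; pose q := #|J|.
pose ix (i : 'I_n) : I := enum_val i.
pose jx (p : 'I_q) : J := enum_val p.
have Pix i : P (ix i) by have := enum_valP i.
have sumP (F : I -> V) : \sum_(i | P i) F i = \sum_(i < n) F (ix i) by rewrite -big_enum_val.
have sumPr (F : I -> rat) : \sum_(i | P i) F i = \sum_(i < n) F (ix i) by rewrite -big_enum_val.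
pose K : 'M[rat]_n := \matrix_(i, j) ev (ix i) (m (ix j)).
pose D : 'M[rat]_(n, q) := \matrix_(j, p) C (jx p) (ix j).
pose W := K *m D.
have WE i p : W i p = ev (ix i) (g (jx p)).
  rewrite mxE gC evsum sumPr; apply: eq_bigr => j _; by rewrite !mxE mulrC.
have Wfree : row_free W.
  apply: inj_row_free => v vW.
  pose z x := \sum_(i < n | ix i == x) v 0 i.
  have zE i : z (ix i) = v 0 i.
    by rewrite /z (eq_bigl (pred1 i)) ?big_pred1_eq // => j; rewrite /= (inj_eq enum_val_inj).
  apply/rowP => i; rewrite mxE -zE; apply: sep => // p.
  rewrite sumPr -(enum_rankK p).
  move/rowP/(_ (enum_rank p)): vW; rewrite !mxE => {2}<-.
  by apply: eq_bigr => j _; rewrite zE WE.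
have Kunit : K \in unitmx.
  rewrite -row_free_unit; apply: inj_row_free => v vK.
  by apply: (row_free_inj Wfree); rewrite mul0mx mulmxA vK mul0mx.
split=> [c c0 i Pi|i Pi].
  have cK : K *m (\col_j c (ix j)) = 0.
    apply/colP => j; rewrite !mxE -[RHS](ev0 (ix j)) -c0 evsum sumPr.
    by apply: eq_bigr => l _; rewrite !mxE mulrC.
  have : \col_j c (ix j) = 0 by rewrite -[LHS](mulKmx Kunit) cK mulmx0.
  move/colP/(_ (enum_rank_in Pi i)); rewrite !mxE /ix enum_rankK_in //.
have [W' WW'] := row_freeP Wfree.
(* K D W' = 1 forces D W' to be the inverse of K. *)
have DWK : D *m (W' *m K) = 1%:M.
  by rewrite -[LHS](mulKmx Kunit) [K *m _]mulmxA -/W [W *m _]mulmxA WW' mul1mx mulVmx.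
pose j := enum_rank_in Pi i.
have jE : ix j = i by rewrite /ix enum_rankK_in.
exists (fun p => (W' *m K) (enum_rank p) j).
under eq_bigr => p _ do rewrite gC sumP scaler_sumr.
have coef l : \sum_p (W' *m K) (enum_rank p) j * C p (ix l) = (l == j)%:R.
  move/matrixP/(_ l j): DWK; rewrite [X in X = _]mxE [X in _ = X]mxE => <-.
  rewrite [RHS](reindex (@enum_rank J)) /=; last exact/onW_bij/enum_rank_bij.
  by apply: eq_bigr => p _; rewrite [D _ _]mxE /jx enum_rankK mulrC.
rewrite exchange_big /= (eq_bigr (fun l => (l == j)%:R *: m (ix l))) => [|l _].
  rewrite (bigD1 j) //= eqxx scale1r jE big1 ?addr0 // => l /negbTE ->.
  by rewrite scale0r.
by rewrite -coef scaler_suml; apply: eq_bigr => p _; rewrite scalerA.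
Qed.

(** A polynomial of degree less than n with n distinct roots is zero. *)
Lemma power_sums_eq0 (n : nat) (c p : 'I_n -> rat) : injective p ->
  (forall k, \sum_(i < n) c i * p k ^+ i = 0) -> forall i, c i = 0.
Proof.
move=> pinj H i.
pose P := \sum_(i < n) c i *: 'X^i : {poly rat}.
have sP : (size P <= n)%N.
  apply: leq_trans (size_sum _ _ _) _; apply/bigmax_leqP => j _.
  by apply: leq_trans (size_scale_leq _ _) _; rewrite size_polyXn.
have P0 : P = 0.
  apply: (@roots_geq_poly_eq0 _ _ [seq p k | k <- enum 'I_n]).
  - apply/allP => _ /mapP[k _ ->]; apply/rootP; rewrite horner_sum -[RHS](H k).
    by apply: eq_bigr => j _; rewrite hornerZ hornerXn.
  - by rewrite map_inj_uniq ?enum_uniq.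
  - by rewrite size_map size_enum_ord.
have := congr1 (fun q : {poly rat} => q`_i) P0.
rewrite coef0 coef_sum (bigD1 i) //= coefZ coefXn eqxx mulr1 big1 ?addr0 // => j ji.
by rewrite coefZ coefXn eq_sym (inj_eq val_inj) (negbTE ji) mulr0.
Qed.

(** * Generation of GL_2 by elementary matrices *)

Definition mk2 (p q r s : rat) : 'M[rat]_2 :=
  \matrix_(i, j) if i == 0 then (if j == 0 then p else q) else (if j == 0 then r else s).

Lemma ord2_cases (i : 'I_2) : i = 0 \/ i = 1.
Proof. by case: i => [[|[|//]] lt]; [left | right]; apply: val_inj. Qed.

Lemma mk2_eta (g : 'M[rat]_2) : g = mk2 (g 0 0) (g 0 1) (g 1 0) (g 1 1).
Proof.
by apply/matrixP=> i j; rewrite mxE; case: (ord2_cases i) => ->; case: (ord2_cases j) => ->.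
Qed.

Lemma mk2M p q r s p' q' r' s' : mk2 p q r s * mk2 p' q' r' s' =
  mk2 (p * p' + q * r') (p * q' + q * s') (r * p' + s * r') (r * q' + s * s').
Proof.
apply/matrixP=> i j; rewrite !mxE !big_ord_recl big_ord0 addr0 !mxE /=.
by case: ifP => _; case: ifP.
Qed.

Lemma det_mk2 p q r s : \det (mk2 p q r s) = p * s - q * r.
Proof.
rewrite (expand_det_row _ 0) !big_ord_recl big_ord0 addr0 /cofactor !det_mx11 !mxE /=.
by rewrite expr0 expr1 mul1r mulN1r mulrN.
Qed.

Lemma GL2_ind (Q : 'M[rat]_2 -> Prop) :
    (forall x y, Q x -> Q y -> Q (x * y)) ->
    (forall i j c, Q (1 + c *: delta_mx i j)) ->
  forall g, \det g != 0 -> Q g.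
Proof.
move=> QM Qel.
have elE i j c : 1 + c *: delta_mx i j =
    mk2 (1 + c * ((i == 0) && (j == 0))%:R) (c * ((i == 0) && (j == 1))%:R)
        (c * ((i == 1) && (j == 0))%:R) (1 + c * ((i == 1) && (j == 1))%:R).
  by rewrite [LHS]mk2_eta !mxE !(eq_sym i) !(eq_sym j) /= !add0r.
have Qu c : Q (mk2 1 c 0 1) by have := Qel 0 1 c; rewrite elE /= !mulr0 !addr0 mulr1.
have Ql c : Q (mk2 1 0 c 1) by have := Qel 1 0 c; rewrite elE /= !mulr0 !addr0 mulr1.
have Qd x y : Q (mk2 x 0 0 y).
  have := QM _ _ (Qel 0 0 (x - 1)) (Qel 1 1 (y - 1)).
  rewrite !elE /= mk2M; congr (Q (mk2 _ _ _ _)); ring.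
have Qs p q r s : s != 0 -> Q (mk2 p q r s).
  move=> s0.
  (* Upper unitriangular times diagonal times lower unitriangular, with pivot s. *)
  have -> : mk2 p q r s = mk2 1 (q / s) 0 1 * mk2 (p - q / s * r) 0 0 s * mk2 1 0 (r / s) 1.
    by rewrite !mk2M; congr mk2; field.
  by apply: (QM) => //; apply: QM.
move=> g; rewrite (mk2_eta g) det_mk2; move: (g 0 0) (g 0 1) (g 1 0) (g 1 1) => p q r s.
have [->|s0 _] := eqVneq s 0; last exact: Qs.
rewrite mulr0 sub0r oppr_eq0 mulf_eq0 negb_or => /andP[_ r0].
(* If s = 0 then r is nonzero; adding the first column to the second makes r the pivot. *)
have -> : mk2 p q r 0 = mk2 p (p + q) r r * mk2 1 (-1) 0 1.
  by rewrite !mk2M; congr mk2; ring.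
by apply: QM => //; apply: Qs.
Qed.

Lemma delta_sq (i j : 'I_2) :
  delta_mx i j * delta_mx i j = delta_mx i j *+ (i == j) :> 'M[rat]_2.
Proof. by rewrite eq_sym; apply: mul_delta_mx_cond. Qed.

(** * The representation of B_d and its image *)

Section Representation.
Variables (d : nat) (A : algType rat) (e f h1 h2 : A).
Hypothesis pres : presents_Bd d e f h1 h2.

Let E (i j : 'I_2) := drho d (delta_mx i j).

Lemma Bd_rep : exists phi : A -> 'M[rat]_(tdim d),
  [/\ is_mx_alg_hom phi, phi e = E 0 1, phi f = E 1 0, phi h1 = E 0 0 & phi h2 = E 1 1].
Proof.
have bracket i j k l : E i j * E k l - E k l * E i j =
    E i l *+ (j == k) - E k j *+ (l == i).
  rewrite drho_bracket drhoB; congr (_ - _).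
    by rewrite [_ * _]mul_delta_mx_cond; case: eqP => // _; apply: drho0.
  by rewrite [_ * _]mul_delta_mx_cond; case: eqP => // _; apply: drho0.
have relE : [/\ E 0 0 * E 1 1 = E 1 1 * E 0 0,
    (E 0 0 * E 0 1 - E 0 1 * E 0 0 = E 0 1) /\
    (E 0 0 * E 1 0 - E 1 0 * E 0 0 = - E 1 0),
    (E 1 1 * E 0 1 - E 0 1 * E 1 1 = - E 0 1) /\
    (E 1 1 * E 1 0 - E 1 0 * E 1 1 = E 1 0),
    E 0 1 * E 1 0 - E 1 0 * E 0 1 = E 0 0 - E 1 1 &
    E 0 0 + E 1 1 = d%:R /\ \prod_(i < d.+1) (E 0 0 - i%:R) = 0].
  split; [|split|split| |split].
  - by apply/eqP; rewrite -subr_eq0 bracket subrr.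
  - by rewrite bracket subr0.
  - by rewrite bracket sub0r.
  - by rewrite bracket sub0r.
  - by rewrite bracket subr0.
  - by rewrite bracket.
  - rewrite -drho1 -[E 0 0]scale1r -drho_lin scale1r; congr drho.
    by apply/matrixP=> i j; rewrite !mxE; case: (ord2_cases i) => ->; case: (ord2_cases j) => ->.
  - have := step_falling_drho d (delta_sq 0 0); rewrite /step_falling => <-.
    by apply: eq_bigr => i _; rewrite mul1n.
(* The operators are generalized so that [tdim d] can be split; the universal property needs a
   successor size. *)
move: relE; move: (E 0 0) (E 0 1) (E 1 0) (E 1 1).
case: (tdim d) => [|n] H1 X Y H2 relE.
  have flat (M N : 'M[rat]_0) : M = N by rewrite [M]flatmx0 [N]flatmx0.
  exists (fun=> 0); split; [|exact: flat..].
  by split=> [k x y|]; [exact: flat | split=> [x y|]; exact: flat].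
case: relE => r1 [r2 r3] [r4 r5] r6 [r7 r8].
have rel : @Brels 'M[rat]_n.+1 d X Y H1 H2 by do 7!split=> //.
case: pres => _ [_ /(_ _ _ _ _ _ rel) [phi [[phih [? [? [? ?]]]] _]]].
by exists phi.
Qed.

Variable phi : A -> 'M[rat]_(tdim d).
Hypothesis hphi : is_mx_alg_hom phi.
Hypotheses (phie : phi e = E 0 1) (phif : phi f = E 1 0).
Hypotheses (phih1 : phi h1 = E 0 0) (phih2 : phi h2 = E 1 1).

Let im (M : 'M[rat]_(tdim d)) : Prop := exists x, phi x = M.

Let im_lin k M N : im M -> im N -> im (k *: M + N).
Proof. by case: hphi => lin _ [x <-] [y <-]; exists (k *: x + y); rewrite lin. Qed.

Let im0 : im 0.
Proof. by exists (0 - 0); case: hphi => lin _; rewrite -scaleN1r addrC lin scaleN1r addNr. Qed.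

Let imM M N : im M -> im N -> im (M * N).
Proof. by case: hphi => _ [mul _] [x <-] [y <-]; exists (x * y); rewrite mul. Qed.

Let im1 : im 1.
Proof. by exists 1; case: hphi => _ []. Qed.

Let im_sum (I : Type) (r : seq I) (c : I -> rat) (M : I -> 'M[rat]_(tdim d)) :
  (forall i, im (M i)) -> im (\sum_(i <- r) c i *: M i).
Proof. by move=> imMi; elim/big_rec: _ => [|i N _ imN]; [exact: im0 | apply: im_lin]. Qed.

Let im_step_falling eps M j : im M -> im (step_falling eps M j).
Proof.
move=> iM; rewrite /step_falling; elim/big_rec: _ => [|i N _ imN]; first exact: im1.
apply: imM => //; rewrite addrC -scaler_nat -scaleNr.
by apply: im_lin; first exact: im1.
Qed.

(** It suffices to treat 1 + c E_ij, whose tensor power is a polynomial in the image of one of the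
    four generators. *)
Let im_gl2 (g : 'M[rat]_2) : \det g != 0 -> im (tensor_pow d g).
Proof.
elim/GL2_ind: g / => [x y imx imy|i j c].
  by rewrite tensor_powM; apply: imM.
rewrite (tensor_pow_1D _ _ (delta_sq i j)); apply: im_sum => k.
apply: im_step_falling; case: (ord2_cases i) => ->; case: (ord2_cases j) => ->.
- by exists h1.
- by exists e.
- by exists f.
- by exists h2.
Qed.

Lemma schur_in_image M : in_schur M -> exists x, phi x = M.
Proof.
case=> s [/allP sdet ->]; rewrite big_seq.
elim/big_rec: _ => [|p N ps imN]; first exact: im0.
by apply: im_lin => //; apply: im_gl2; apply: sdet.
Qed.

End Representation.

(** * Matrix entries separating the monomials *)

(* The entry of g^{(x) d} at (row_word t, col_word t), t = (a, b, c), is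
   g_01^a g_00^b g_10^c g_11^(d-a-b-c). *)
Definition row_word d (t : triple d) : tidx d :=
  [ffun k : 'I_d => if (k < t.1.1 + t.1.2)%N then 0 else 1].
Definition col_word d (t : triple d) : tidx d :=
  [ffun k : 'I_d => if (t.1.1 <= k < t.1.1 + t.1.2 + t.2)%N then 0 else 1].

Definition word_entry d (t : triple d) (M : 'M[rat]_(tdim d)) : rat :=
  M (enum_rank (row_word t)) (enum_rank (col_word t)).

Lemma word_entry_tensor_pow d (t : triple d) (p q r s : rat) : triple_ok t ->
  word_entry t (tensor_pow d (mk2 p q r s)) =
    q ^+ t.1.1 * p ^+ t.1.2 * r ^+ t.2 * s ^+ (d - (t.1.1 + t.1.2 + t.2)).
Proof.
case: t => [[a b] c]; rewrite /triple_ok /= => ok.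
rewrite /word_entry mxE !enum_rankK.
(* The pair of letters at slot k is constant on four consecutive intervals. *)
pose F k := if (k < a)%N then q else if (k < a + b)%N then p else
  if (k < a + b + c)%N then r else s.
rewrite (eq_bigr (fun k : 'I_d => F k)) => [|k _]; last first.
  rewrite !ffunE mxE /= /F.
  have [ka|ka] := ltnP k a.
    by rewrite (_ : (k < a + b)%N = true) //; lia.
  have [kb|kb] := ltnP k (a + b)%N.
    by rewrite (_ : (k < a + b + c)%N = true) //; lia.
  by case: ltnP.
rewrite -(big_mkord xpredT F) (@big_cat_nat _ _ _ a) //=; last by lia.
rewrite (@big_cat_nat _ _ _ (a + b) a) //=; [|lia|lia].
rewrite (@big_cat_nat _ _ _ (a + b + c) (a + b)) //=; [|lia].
have cst m n x : (forall k, (m <= k < n)%N -> F k = x) -> \prod_(m <= k < n) F k = x ^+ (n - m).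
  by move=> Fx; rewrite (eq_big_nat _ _ Fx) prodr_const_nat.
rewrite (cst 0%N a q) ?(cst a (a + b)%N p) ?(cst (a + b)%N (a + b + c)%N r)
        ?(cst (a + b + c)%N d s).
- by rewrite subn0 !addKn !mulrA.
all: by move=> k hk; rewrite /F; do ?case: ltnP => ? //; lia.
Qed.

(** Sample points [[x, t], [u, 1]]. As t and u are at most d, the offset d^2 + 1 in x keeps the
    determinant x - t u positive. *)
Definition grid_mx d (p : triple d) : 'M[rat]_2 :=
  mk2 (d * d + p.1.2).+1%:R p.1.1%:R p.2%:R 1.

Lemma det_grid_mx d (p : triple d) : \det (grid_mx p) != 0.
Proof.
rewrite det_mk2 mulr1 -natrM subr_eq0 eqr_nat.
by have := ltn_ord p.1.1; have := ltn_ord p.2; nia.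
Qed.

Lemma sum_triple d (F : triple d -> rat) :
  \sum_t F t = \sum_(a < d.+1) \sum_(b < d.+1) \sum_(c < d.+1) F (a, b, c).
Proof. by rewrite pair_bigA pair_bigA; apply: eq_bigr => -[[a b] c]. Qed.

(** The entries are t^a x^b u^c, so z is the coefficient family of a polynomial of degree at most d
    in each variable that vanishes on a grid with d + 1 values per variable. *)
Lemma grid_separated d (z : triple d -> rat) :
    (forall p : triple d,
       \sum_(t : triple d | triple_ok t) z t * word_entry t (tensor_pow d (grid_mx p)) = 0) ->
  forall t : triple d, triple_ok t -> z t = 0.
Proof.
(* Extension by zero to the whole cube lets the three variables be eliminated one at a time. *)
move=> H; pose z' (t : triple d) := if triple_ok t then z t else 0.
suff z0 a b c : z' (a, b, c) = 0.
  by case=> [[a b] c] ok; have := z0 a b c; rewrite /z' ok.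
have natI (n m : nat) : injective (fun i : 'I_n => (m + i)%:R : rat).
  by move=> i j /eqP; rewrite eqr_nat eqn_add2l => /eqP /val_inj.
apply: (power_sums_eq0 (natI _ 0) (c := fun c => z' (a, b, c))) => w /=.
apply: (power_sums_eq0 (natI _ (d * d).+1)
  (c := fun b => \sum_(c < d.+1) z' (a, b, c) * (0 + w)%:R ^+ c)) => v /=.
apply: (power_sums_eq0 (natI _ 0) (c := fun a => \sum_(b < d.+1)
  (\sum_(c < d.+1) z' (a, b, c) * (0 + w)%:R ^+ c) * ((d * d).+1 + v)%:R ^+ b)) => u /=.
rewrite -[RHS](H (u, v, w)) [RHS]big_mkcond /=.
rewrite sum_triple.
apply: eq_bigr => i _; rewrite mulr_suml; apply: eq_bigr => j _.
rewrite !mulr_suml; apply: eq_bigr => k _; rewrite /z'.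
case: ifP => ok; last by rewrite !mul0r.
rewrite word_entry_tensor_pow //= expr1n !add0n addSn; ring.
Qed.

(** * The isomorphism and the two bases *)

Lemma in_schur_tensor_pow d (g : 'M[rat]_2) : \det g != 0 -> in_schur (tensor_pow d g).
Proof. by move=> g0; exists [:: (1, g)]; rewrite /= g0 big_seq1 scale1r. Qed.

Lemma in_schur_comb d k (M N : 'M[rat]_(tdim d)) :
  in_schur M -> in_schur N -> in_schur (k *: M + N).
Proof.
case=> [s [sdet ->]] [t [tdet ->]].
exists ([seq (k * p.1, p.2) | p <- s] ++ t); rewrite all_cat all_map big_cat big_map.
split; first exact/andP.
by rewrite scaler_sumr; congr (_ + _); apply: eq_bigr => p _; rewrite scalerA.
Qed.

Lemma in_schur_spanned d (I : finType) (P : pred I) (g : I -> 'M[rat]_(tdim d)) M :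
  (forall i, P i -> in_schur (g i)) -> spanned P g M -> in_schur M.
Proof.
move=> Sg; apply: spanned_ind => //; last exact: in_schur_comb.
by exists [::]; rewrite big_nil.
Qed.

Lemma Bd_schur_basis d (A : algType rat) (e f h1 h2 : A) :
  presents_Bd d e f h1 h2 ->
  (exists phi : A -> 'M[rat]_(tdim d),
      is_mx_alg_hom phi /\ injective phi /\
      (forall M, in_schur M <-> exists x, phi x = M)) /\
  is_basis (triple_ok (d:=d))
    (fun t : triple d => e ^+ t.1.1 * h1 ^+ t.1.2 * f ^+ t.2).
Proof.
move=> pres; have [phi [hphi phie phif phih1 phih2]] := Bd_rep pres.
have [rel [gen _]] := pres.
have span := Bd_spanned rel gen.
pose v (t : triple d) := e ^+ t.1.1 * h1 ^+ t.1.2 * f ^+ t.2.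
have [lin _] := hphi.
have phi0 : phi 0 = 0.
  by rewrite -[X in phi X](subrr 0) addrC -scaleN1r lin scaleN1r addNr.
have phi_sum (c : triple d -> rat) : phi (\sum_(t | triple_ok t) c t *: v t) =
    \sum_(t | triple_ok t) c t *: phi (v t).
  by elim/big_rec2: _ => // t x y _ <-; rewrite lin.
(* Applied to the images of the monomials and the grid tensor powers, this gives both independence
   and the inclusion of the image in S(2,d). *)
have [] := @free_of_spanned_separated _ _ _ (@triple_ok d) (phi \o v)
  (fun p : triple d => tensor_pow d (grid_mx p)) (@word_entry d).
- by move=> t k x y; rewrite /word_entry !mxE.
- move=> p.
  have [|x <-] := schur_in_image hphi phie phif phih1 phih2 (M := tensor_pow d (grid_mx p)).
    exact/in_schur_tensor_pow/det_grid_mx.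
  by have [c ->] := span x; exists c; rewrite phi_sum.
- exact: grid_separated.
move=> free gspan; split; last first.
  split=> // c c0 t ok; apply: (free c) => //.
  by rewrite -phi_sum c0 phi0.
exists phi; split=> //; split=> [x y xy|M]; last split.
- have [c xyE] := span (x - y).
  have pc : phi (x - y) = 0 by rewrite addrC -scaleN1r lin xy scaleN1r addNr.
  apply/eqP; rewrite -subr_eq0 xyE big1 // => t ok.
  by rewrite (free c) ?scale0r //; rewrite -phi_sum -xyE.
- exact: schur_in_image hphi phie phif phih1 phih2 M.
case=> x <-; have [c ->] := span x; rewrite phi_sum.
apply: (in_schur_spanned (P := @triple_ok d) (g := phi \o v)); last by exists c.
move=> t /gspan; apply: in_schur_spanned => p _.
exact/in_schur_tensor_pow/det_grid_mx.
Qed.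

(** Only the truncation relation is not visibly symmetric; for h2 = d - h1, reversing the index i to
    d - i gives the same product up to the sign (-1)^(d+1). *)
Lemma presents_Bd_sym d (A : algType rat) (e f h1 h2 : A) :
  presents_Bd d e f h1 h2 -> presents_Bd d f e h2 h1.
Proof.
have sym (B : algType rat) (x y k1 k2 : B) : Brels d x y k1 k2 -> Brels d y x k2 k1.
  case=> [c [r1 [r2 [r3 [r4 [r5 [D r6]]]]]]]; do 6!split=> //.
  - by rewrite -opprB r5 opprB.
  split; first by rewrite addrC.
  have -> : k2 = d%:R - k1 by rewrite -D addrC addKr.
  (* The products are compared in the commutative ring of polynomials and then evaluated at k1. *)
  have evalE (q : nat -> {poly rat}) (F : nat -> B) :
      (forall i, horner_alg k1 (q i) = F i) ->
      horner_alg k1 (\prod_(i < d.+1) q i) = \prod_(i < d.+1) F i.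
    by move=> qF; rewrite rmorph_prod; apply: eq_bigr => i _; apply: qF.
  rewrite -(evalE (fun i => d%:R - 'X - i%:R) (fun i => d%:R - k1 - i%:R)) => [|i]; last first.
    by rewrite !rmorphB !rmorph_nat /= horner_algX.
  have -> : \prod_(i < d.+1) (d%:R - 'X - i%:R) =
      (-1) ^+ d.+1 * \prod_(i < d.+1) ('X - i%:R) :> {poly rat}.
    rewrite (reindex_inj rev_ord_inj) -[in (-1) ^+ _](card_ord d.+1) -prodrN.
    apply: eq_bigr => i _ /=; rewrite subSS natrB -1?ltnS //; ring.
  rewrite rmorphM /= (evalE (fun i => 'X - i%:R) (fun i => k1 - i%:R)) => [|i]; last first.
    by rewrite rmorphB rmorph_nat /= horner_algX.
  by rewrite r6 mulr0.
case=> rel [gen univ]; split; [exact: sym | split].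
  move=> P P1 Pf Pe Ph2 Ph1; exact: gen.
move=> B e' f' h1' h2' /sym /univ [phi [[hom [? [? [? ?]]]] uniq]].
exists phi; split=> // psi [psih [? [? [? ?]]]]; exact: uniq.
Qed.

Theorem theorem5p2 (d : nat) (A : algType rat) (e f h1 h2 : A) :
  presents_Bd d e f h1 h2 ->
  (exists phi : A -> 'M[rat]_(tdim d),
      is_mx_alg_hom phi /\ injective phi /\
      (forall M, in_schur M <-> exists x, phi x = M)) /\
  is_basis (triple_ok (d:=d))
    (fun t : triple d => e ^+ t.1.1 * h1 ^+ t.1.2 * f ^+ t.2) /\
  is_basis (triple_ok (d:=d))
    (fun t : triple d => f ^+ t.1.1 * h2 ^+ t.1.2 * e ^+ t.2).
Proof.
move=> pres; have [schur basis1] := Bd_schur_basis pres.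
by have [_ basis2] := Bd_schur_basis (presents_Bd_sym pres).
Qed.
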